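(* Let $R$ be a commutative unital ring, let $(V,\partial_V)$ and $(W,\partial_W)$ be chain complexes of $R$-modules, let $f:(V,\partial_V)\to(W,\partial_W)$ and $g:(W,\partial_W)\to(V,\partial_V)$ be chain maps, let $h:V\to V$ be a chain homotopy (a degree $+1$ map) between $gf$ and $\mathrm{id}_V$, and let $\mu=(\mu_2,\mu_3,\dots)$ be an $A_\infty$-structure on $(V,\partial_V)$. Let $p_n:V^{\otimes n}\to V$, $n\ge 2$, be defined inductively by $p_2:=\mu_2$ and $$p_n:=\sum_{\substack{2\le k\le n,\ r_1,\dots,r_k\ge 1\\ r_1+\cdots+r_k=n}}(-1)^{\vartheta(r_1,\dots,r_k)}\,\mu_k\big(h\circ p_{r_1}\otimes\cdots\otimes h\circ p_{r_k}\big),$$ with the formal convention $h\circ p_1:=\mathrm{id}_V$. Then for each $n\ge 2$ $$p_n=\sum_{T\in \mathtt{P}_n}(-1)^{\vartheta(T)}\,F_T,$$ where $\mathtt{P}_n$ is the set of planar rooted trees with $n$ leaves all of whose vertices have at least two incoming edges, and the maps $F_T$ and the signs $\vartheta(T)$ are those defined in the context.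
   Context: Chain complexes are $\mathbb Z$-graded with differentials of degree $-1$; tensor products are over $R$; the Koszul sign convention is used throughout (e.g. $(a\otimes b)(x\otimes y)=(-1)^{|b||x|}a(x)\otimes b(y)$). For integers $u_1,\dots,u_s$ put $\vartheta(u_1,\dots,u_s):=\sum_{1\le\alpha<\beta\le s}u_\alpha(u_\beta+1)$. An $A_\infty$-structure on $(V,\partial_V)$ is a sequence of linear maps $\mu_n:V^{\otimes n}\to V$ of degree $n-2$ ($n\ge2$) such that for all $n\ge 2$, $\delta(\mu_n)=\sum_{k+l=n+1,\ k,l\ge 2,\ 1\le i\le k}(-1)^{i(l+1)+n}\mu_k(\mathrm{id}^{\otimes i-1}\otimes\mu_l\otimes\mathrm{id}^{\otimes k-i})$, where $\delta(F)=\partial\circ F-(-1)^{|F|}F\circ\partial$. Trees: planar rooted trees are directed towards the root; every vertex has an ordered (left to right) list of incoming edges, and its arity is their number. Leaves (legs) are the external input edges; they are not vertices. In the elements of $\mathtt{P}_n$ every interior edge (edge joining two vertices) is decorated by a symbol standing for $h$; leaves and the root edge carry no decoration. The map $F_T:V^{\otimes n}\to V$ for $T\in\mathtt{P}_n$ is obtained by reading $T$ as a flow chart, each vertex of arity $k$ denoting $\mu_k$ and each interior edge denoting $h$. Explicitly, if the root vertex of $T$ has arity $k$, then $F_T=\mu_k(G_1\otimes\cdots\otimes G_k)$, where $G_j=\mathrm{id}_V$ if the $j$-th incoming edge of the root vertex is a leaf, and $G_j=h\circ F_{T_j}$ if the $j$-th incoming edge is an interior edge, $T_j$ being the subtree attached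 there. The sign: for a vertex $v$ of $T$ of arity $k$ and $1\le i\le k$, let $r_i$ be the number of leaves $e$ of $T$ such that the unique path from $e$ to the root contains the $i$-th incoming edge of $v$. Put $\vartheta_T(v):=\vartheta(r_1,\dots,r_k)$ and $\vartheta(T):=\sum_{v}\vartheta_T(v)$, the sum over all vertices $v$ of $T$. *)

(* Defs.v *)
(* MathComp, with the classical layer of MathComp-Analysis. *)
From HB Require Import structures.
From mathcomp Require Import all_boot all_order all_algebra.
From mathcomp Require Import mathcomp_extra boolp classical_sets functions.
From mathcomp Require Import cardinality fsbigop.

Set Implicit Arguments.
Unset Strict Implicit.
Unset Printing Implicit Defensive.

Import GRing.Theory.
Local Open Scope ring_scope.
Local Open Scope quotient_scope.

(* (-1)^m for m : int; only the parity of m matters. *)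
Definition ksign (R : pzRingType) (m : int) : R := (-1) ^+ `|m|%N.

Definition vartheta (u : seq int) : int :=
  \sum_(b < size u) \sum_(a < size u | (a < b)%N) u`_a * (u`_b + 1).

Definition multilinear (R : pzRingType) (V U : lmodType R) (n : nat)
    (f : seq V -> U) : Prop :=
  forall (s1 s2 : seq V) (a : R) (u v : V), (size s1 + size s2).+1 = n ->
    f (s1 ++ (a *: u + v) :: s2) = a *: f (s1 ++ u :: s2) + f (s1 ++ v :: s2).

Section TensorPower.
Context (R : comPzRingType) (V : lmodType R) (n : nat).

(* Formal linear combinations of n-tuples of vectors; [teq] is the congruence
   presenting V^{(x) n} by generators x_1 (x) ... (x) x_n and multilinearity
   relations. *)
Definition formal : Type := seq (R * n.-tuple V).

Inductive teq : formal -> formal -> Prop :=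
| teq_refl s : teq s s
| teq_sym s t : teq s t -> teq t s
| teq_trans s t u : teq s t -> teq t u -> teq s u
| teq_cat s s' t t' : teq s s' -> teq t t' -> teq (s ++ t) (s' ++ t')
| teq_catC s t : teq (s ++ t) (t ++ s)
| teq_zero x : teq [:: (0, x)] [::]
| teq_add a b x : teq [:: (a + b, x)] [:: (a, x); (b, x)]
| teq_lin c a u v s1 s2 (x y z : n.-tuple V) :
    val x = s1 ++ (a *: u + v) :: s2 ->
    val y = s1 ++ u :: s2 -> val z = s1 ++ v :: s2 ->
    teq [:: (c, x)] [:: (c * a, y); (c, z)].

Definition teqb (s t : formal) : bool := `[< teq s t >].

Lemma teqb_equiv : equiv_class_of teqb.
Proof.
split.
- by move=> s; apply/asboolP; apply: teq_refl.
- by move=> s t; apply/asboolP/asboolP; apply: teq_sym.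
- by move=> t s u /asboolP h1 /asboolP h2; apply/asboolP; apply: teq_trans h2.
Qed.

Canonical teq_equiv := EquivRelPack teqb_equiv.

Definition tpow : Type := {eq_quot teq_equiv}.
HB.instance Definition _ := Choice.on tpow.

Definition tclass (s : formal) : tpow := \pi_({eq_quot teq_equiv}) s.

Lemma tclassP (s t : formal) : teq s t <-> tclass s = tclass t.
Proof.
split; first by move=> h; apply/eqmodP/asboolP.
by move/eqmodP/asboolP.
Qed.

Definition trepr (t : tpow) : formal := repr t.

Lemma treprK (t : tpow) : tclass (trepr t) = t.
Proof. exact: reprK. Qed.

Lemma teq_repr (s : formal) : teq (trepr (tclass s)) s.
Proof. by apply/tclassP; rewrite treprK. Qed.

Definition fscale (a : R) (s : formal) : formal :=
  [seq (a * q.1, q.2) | q <- s].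

Lemma teq_fscale a s t : teq s t -> teq (fscale a s) (fscale a t).
Proof.
elim=> {s t} [s|s t _ h|s t u _ h1 _ h2|s s' t t' _ h1 _ h2|s t|x|b c x|
  c b u v s1 s2 x y z hx hy hz] /=.
- exact: teq_refl.
- exact: teq_sym.
- exact: teq_trans h2.
- by rewrite /fscale !map_cat; apply: teq_cat.
- by rewrite /fscale !map_cat; apply: teq_catC.
- by rewrite mulr0; apply: teq_zero.
- by rewrite mulrDr; apply: teq_add.
- by rewrite mulrA; apply: teq_lin hx hy hz.
Qed.

Definition tadd (t u : tpow) : tpow := tclass (trepr t ++ trepr u).
Definition tscale (a : R) (t : tpow) : tpow := tclass (fscale a (trepr t)).
Definition topp (t : tpow) : tpow := tscale (-1) t.
Definition tzero : tpow := tclass [::].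

Lemma taddE s t : tadd (tclass s) (tclass t) = tclass (s ++ t).
Proof. by apply/tclassP; apply: teq_cat; apply: teq_repr. Qed.

Lemma tscaleE a s : tscale a (tclass s) = tclass (fscale a s).
Proof. by apply/tclassP; apply: teq_fscale; apply: teq_repr. Qed.

Lemma fscaleDl a b s : teq (fscale (a + b) s) (fscale a s ++ fscale b s).
Proof.
elim: s => [|[c x] s IH] /=; first exact: teq_refl.
rewrite mulrDl -cat1s; apply: (teq_trans (teq_cat (teq_add _ _ x) IH)) => /=.
rewrite -/(fscale a s) -/(fscale b s) -cat1s -[X in teq _ X]cat1s.
apply: teq_cat; first exact: teq_refl.
rewrite -cat1s catA -[(b * c, x) :: fscale b s]cat1s catA.
by apply: teq_cat; [apply: teq_catC | apply: teq_refl].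
Qed.

Lemma fscale0 s : teq (fscale 0 s) [::].
Proof.
elim: s => [|[c x] s IH] /=; first exact: teq_refl.
by rewrite mul0r -cat1s -[X in teq _ X]cat0s; apply: teq_cat IH; apply: teq_zero.
Qed.

Lemma fscale1 s : fscale 1 s = s.
Proof. by elim: s => //= -[c x] s ->; rewrite mul1r. Qed.

Lemma taddA : associative tadd.
Proof.
move=> t u v; rewrite -(treprK t) -(treprK u) -(treprK v) !taddE.
by rewrite catA.
Qed.

Lemma taddC : commutative tadd.
Proof. by move=> t u; apply/tclassP; apply: teq_catC. Qed.

Lemma tadd0 : left_id tzero tadd.
Proof. by move=> t; rewrite -(treprK t) taddE. Qed.

Lemma taddN : left_inverse tzero topp tadd.
Proof.
move=> t; rewrite -(treprK t) /topp tscaleE taddE; apply/tclassP.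
rewrite -[X in _ ++ X]fscale1; apply: (teq_trans (teq_sym (fscaleDl _ _ _))).
by rewrite addNr; apply: fscale0.
Qed.

HB.instance Definition _ := GRing.isZmodule.Build tpow taddA taddC tadd0 taddN.

Lemma tscaleA a b t : tscale a (tscale b t) = tscale (a * b) t.
Proof.
rewrite -(treprK t) !tscaleE /fscale -map_comp; congr tclass.
by apply: eq_map => q /=; rewrite mulrA.
Qed.

Lemma tscale1 : left_id 1 tscale.
Proof. by move=> t; rewrite -(treprK t) tscaleE fscale1. Qed.

Lemma tscaleDr : right_distributive tscale +%R.
Proof.
move=> a t u; rewrite -(treprK t) -(treprK u) [tclass _ + _]taddE !tscaleE [RHS]taddE.
by rewrite /fscale map_cat.
Qed.

Lemma tscaleDl t : {morph tscale^~ t : a b / a + b}.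
Proof.
move=> a b; rewrite -(treprK t) !tscaleE [RHS]taddE; apply/tclassP.
exact: fscaleDl.
Qed.

HB.instance Definition _ := GRing.Zmodule_isLmodule.Build R tpow
  tscaleA tscale1 tscaleDr tscaleDl.

(* x_1 (x) ... (x) x_n, with the junk value 0 if s does not have length n. *)
Definition tensor (s : seq V) : tpow :=
  if insub s is Some x then tclass [:: (1, x)] else 0.

Lemma tensor_tuple (x : n.-tuple V) : tensor x = tclass [:: (1, x)].
Proof. by rewrite /tensor valK. Qed.

Lemma tensor_multilinear : multilinear n tensor.
Proof.
move=> s1 s2 a u v hn.
have hsz w : size (s1 ++ w :: s2) == n by rewrite size_cat /= addnS hn.
have hE w : tensor (s1 ++ w :: s2) = tclass [:: (1, Tuple (hsz w))].
  exact: (tensor_tuple (Tuple (hsz w))).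
rewrite !hE [a *: tclass _]tscaleE [RHS]taddE; apply/tclassP => /=.
apply: (teq_trans (teq_lin (a := a) (u := u) (v := v) (s1 := s1) (s2 := s2)
  (y := Tuple (hsz u)) (z := Tuple (hsz v)) _ _ _ _)) => //.
by rewrite mul1r mulr1; apply: teq_refl.
Qed.

Lemma tpow_span (t : tpow) :
  t = \sum_(q <- trepr t) q.1 *: tensor q.2.
Proof.
rewrite -[LHS]treprK; elim: (trepr t) => [|[c x] s IH].
  by rewrite big_nil.
rewrite big_cons -IH tensor_tuple [_ *: _]tscaleE [RHS]taddE /=.
by rewrite mulr1.
Qed.

End TensorPower.

Section Lift.
Context (R : comPzRingType) (V U : lmodType R) (n : nat).

Record multilin := Multilin {
  mlfun :> seq V -> U;
  mlfunP : multilinear n mlfun }.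

Definition tlift (f : multilin) (t : tpow V n) : U :=
  \sum_(q <- trepr t) q.1 *: f q.2.

Variable f : multilin.

Lemma teq_tlift (s t : formal V n) : teq s t ->
  \sum_(q <- s) q.1 *: f q.2 = \sum_(q <- t) q.1 *: f q.2.
Proof.
elim=> {s t} [s|s t _ h|s t u _ h1 _ h2|
  s s' t t' _ h1 _ h2|s t|x|b c x|c b u v s1 s2 x y z hx hy hz] //=.
- by rewrite h1.
- by rewrite !big_cat h1 h2.
- by rewrite !big_cat /= addrC.
- by rewrite big_seq1 big_nil scale0r.
- by rewrite !big_cons !big_nil /= !addr0 scalerDl.
rewrite !big_cons !big_nil /= !addr0 hx hy hz mlfunP; last first.
  by rewrite -(size_tuple y) hy size_cat /= addnS.
by rewrite scalerDr scalerA.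
Qed.

Lemma tlift_class (s : formal V n) :
  tlift f (tclass s) = \sum_(q <- s) q.1 *: f q.2.
Proof. by apply: teq_tlift; apply: teq_repr. Qed.

Lemma tlift_is_linear : linear (tlift f).
Proof.
move=> a t u; rewrite -(treprK t) -(treprK u) [a *: tclass _]tscaleE [tclass _ + _]taddE.
rewrite !tlift_class big_cat /= scaler_sumr big_map; congr (_ + _).
by apply: eq_bigr => q _; rewrite scalerA.
Qed.

HB.instance Definition _ := GRing.isLinear.Build R (tpow V n) U *:%R (tlift f)
  tlift_is_linear.

Lemma tliftE (s : seq V) : size s = n -> tlift f (tensor n s) = f s.
Proof.
move/eqP=> hs; rewrite (tensor_tuple (Tuple hs)) tlift_class big_seq1.
by rewrite scale1r.
Qed.

End Lift.

(* A Z-graded module is its total module together with the projections onto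
   the homogeneous components. *)
Record gradedModule (R : pzRingType) := GradedModule {
  gcarrier :> lmodType R;
  gproj : int -> {linear gcarrier -> gcarrier};
  gproj_idem : forall i j x,
    gproj i (gproj j x) = if i == j then gproj j x else 0;
  gproj_finite : forall x, finite_set [set i | gproj i x != 0];
  gproj_sum : forall x, \sum_(i \in [set: int]) gproj i x = x }.

Definition homog (R : pzRingType) (V : gradedModule R) (i : int) (x : V) :
  Prop := gproj V i x = x.

Definition has_degree (R : pzRingType) (V W : gradedModule R) (d : int)
    (f : V -> W) : Prop :=
  forall i x, homog i x -> homog (i + d) (f x).

Record chainComplex (R : pzRingType) := ChainComplex {
  cgraded :> gradedModule R;
  cdiff : {linear cgraded -> cgraded};
  cdiff_degree : has_degree (-1) cdiff;
  cdiff_diff : forall x, cdiff (cdiff x) = 0 }.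

Definition chain_map (R : pzRingType) (V W : chainComplex R) (f : V -> W) :
  Prop := has_degree 0 f /\ forall x, f (cdiff V x) = cdiff W (f x).

Definition chain_homotopy (R : pzRingType) (V W : chainComplex R)
    (h f g : V -> W) : Prop :=
  has_degree 1 h /\
  forall x, f x - g x = cdiff W (h x) + h (cdiff V x).

(* The degree m part of V^{(x) n} is spanned by the x_1 (x) ... (x) x_n with
   x_j homogeneous of degree d_j and d_1 + ... + d_n = m. *)
Definition thomog (R : comPzRingType) (V : gradedModule R) (n : nat) (m : int)
    (t : tpow V n) : Prop :=
  exists2 s : formal V n,
    forall q, q \in s -> exists2 d : 'I_n -> int,
      forall j, homog (d j) (tnth q.2 j) & \sum_(j < n) d j = m
  & t = \sum_(q <- s) q.1 *: tensor n q.2.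

Definition thas_degree (R : comPzRingType) (V : gradedModule R) (n : nat)
    (d : int) (F : tpow V n -> V) : Prop :=
  forall i t, thomog i t -> homog (i + d) (F t).

Section Koszul.
Context (R : comPzRingType) (V : gradedModule R).

(* The linear map x |-> (-1)^{d |x|} x. *)
Definition ktwist (d : int) (x : V) : V :=
  \sum_(i \in [set: int]) ksign R (d * i) *: gproj V i x.

Lemma ktwist_seq (s : seq int) d x : uniq s ->
  (forall i, i \notin s -> gproj V i x = 0) ->
  ktwist d x = \sum_(i <- s) ksign R (d * i) *: gproj V i x.
Proof.
move=> us hs; rewrite /ktwist (fsbigE s) //=.
- by apply: eq_bigl => i; rewrite in_setT.
- by move=> i _ /hs ->; rewrite scaler0.
Qed.

Lemma gproj_supp (x : V) :
  exists s : seq int, forall i, i \notin s -> gproj V i x = 0.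
Proof.
have /finite_seqP[s hs] := gproj_finite x.
exists s => i his; apply/eqP; apply: contraNT his => hi.
have : [set i | gproj V i x != 0]%classic i by [].
by rewrite hs.
Qed.

Lemma ktwist_is_linear d : linear (ktwist d).
Proof.
move=> a x y; have [sx hx] := gproj_supp x; have [sy hy] := gproj_supp y.
pose s := undup (sx ++ sy).
have hs i : i \notin s -> gproj V i x = 0 /\ gproj V i y = 0.
  rewrite /s mem_undup mem_cat negb_or => /andP[/hx -> /hy ->].
  by split.
rewrite !(@ktwist_seq s) ?undup_uniq //.
- rewrite scaler_sumr -big_split; apply: eq_bigr => i _ /=.
  by rewrite linearP scalerDr !scalerA mulrC.
- by move=> i /hs[].
- by move=> i /hs[].
- by move=> i /hs[hxi hyi]; rewrite linearP hxi hyi scaler0 addr0.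
Qed.

HB.instance Definition _ d := GRing.isLinear.Build R V V *:%R (ktwist d)
  (ktwist_is_linear d).

Lemma ktwist_homog d i x : homog i x -> ktwist d x = ksign R (d * i) *: x.
Proof.
move=> hx; rewrite (@ktwist_seq [:: i]) //; first by rewrite big_seq1 hx.
move=> j; rewrite inE => /negPf hj.
by rewrite -hx gproj_idem hj.
Qed.

(* A linear map V^{(x) r} -> V together with its degree; the degree only
   enters through Koszul signs. *)
Record operation := Operation {
  op_arity : nat;
  op_degree : int;
  op_map :> {linear tpow V op_arity -> V} }.

(* The factors of (G_1 (x) ... (x) G_k)(x_1 (x) ... (x) x_n), obtained from
   (a (x) b)(x (x) y) = (-1)^{|b||x|} a(x) (x) b(y) with a = G_1 and
   b = G_2 (x) ... (x) G_k. *)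
Fixpoint tens_factors (G : seq operation) (x : seq V) : seq V :=
  if G is a :: b then
    a (tensor (op_arity a)
         [seq ktwist (\sum_(c <- b) op_degree c) y | y <- take (op_arity a) x])
    :: tens_factors b (drop (op_arity a) x)
  else [::].

Definition tens_shape (n k : nat) (G : seq operation) : bool :=
  (size G == k) && (sumn [seq op_arity a | a <- G] == n).

Definition tens_fun (n k : nat) (G : seq operation) (x : seq V) : tpow V k :=
  if tens_shape n k G then tensor k (tens_factors G x) else 0.

Lemma size_tens_factors G x : size (tens_factors G x) = size G.
Proof. by elim: G x => //= a b IH x; rewrite IH. Qed.

Lemma tens_factors_linear G s1 s2 :
  (size s1 + size s2).+1 = sumn [seq op_arity a | a <- G] ->
  exists l1 l2 (phi : V -> V), [/\ (size l1 + size l2).+1 = size G,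
    linear phi & forall w,
    tens_factors G (s1 ++ w :: s2) = l1 ++ phi w :: l2].
Proof.
elim: G s1 => [|a b IH] s1 //= hs.
set tw := map (ktwist _).
have [hlt|hge] := ltnP (size s1) (op_arity a).
  exists [::], (tens_factors b (drop (op_arity a - (size s1).+1) s2)).
  pose s2' := take (op_arity a - (size s1).+1) s2.
  exists (fun w => a (tensor (op_arity a) (tw (s1 ++ w :: s2')))).
  split; first by rewrite size_tens_factors.
  - move=> c u v; rewrite /tw !map_cat /= linearP tensor_multilinear ?linearP //.
    rewrite !size_map /s2' size_take_min (minn_idPl _) ?subnKC // -?addSn ?subnKC //.
    rewrite leq_subLR addSn hs; exact: leq_addr.
  - move=> w; rewrite take_cat drop_cat ltnNge (ltnW hlt) /=.
    by rewrite -(@subnSK (size s1) (op_arity a)).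
have [|l1 [l2 [phi [hl hphi hE]]]] := IH (drop (op_arity a) s1).
  apply/eqP; rewrite -(eqn_add2l (op_arity a)) -hs size_drop.
  by rewrite addnS addnA subnKC.
exists (a (tensor (op_arity a) (tw (take (op_arity a) s1))) :: l1), l2, phi.
split=> //=; first by rewrite -hl.
move=> w; rewrite -hE; congr (a (tensor _ (tw _)) :: tens_factors _ _).
  rewrite take_cat; case: ltnP => // hle.
  have/eqP-> : op_arity a == size s1 by rewrite eqn_leq hge.
  by rewrite subnn take0 cats0 take_size.
rewrite drop_cat; case: ltnP => // hle.
have/eqP-> : op_arity a == size s1 by rewrite eqn_leq hge.
by rewrite subnn drop0 drop_size.
Qed.

Lemma tens_fun_multilinear n k G : multilinear n (tens_fun n k G).
Proof.
move=> s1 s2 a u v hs; rewrite /tens_fun.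
case: ifP => [/andP[/eqP hk /eqP hn]|_]; last by rewrite scaler0 addr0.
have [|l1 [l2 [phi [hl hphi hE]]]] := @tens_factors_linear G s1 s2.
  by rewrite hn.
by rewrite !hE hphi tensor_multilinear // hl.
Qed.

(* G_1 (x) ... (x) G_k : V^{(x) n} -> V^{(x) k}; the junk value is 0 when the
   number of factors is not k or their arities do not add up to n. *)
Definition tens (n k : nat) (G : seq operation) : tpow V n -> tpow V k :=
  tlift (Multilin (@tens_fun_multilinear n k G)).
Arguments tens : clear implicits.

HB.instance Definition _ n k G := GRing.Linear.on (tens n k G).

Lemma tensE n k G x : tens_shape n k G -> size x = n ->
  tens n k G (tensor n x) = tensor k (tens_factors G x).
Proof. by move=> hG hx; rewrite /tens tliftE //= /tens_fun hG. Qed.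

Lemma head_multilinear : multilinear 1%N (head (0 : V)).
Proof. by case=> [|? ?] //= s2 a u v []. Qed.

Definition tpow1 : tpow V 1%N -> V := tlift (Multilin head_multilinear).
HB.instance Definition _ := GRing.Linear.on tpow1.

Definition op_unary (d : int) (f : {linear V -> V}) : operation :=
  @Operation 1%N d (f \o tpow1).

Definition op_id : operation := op_unary 0 idfun.

End Koszul.

Arguments tens {R V} n k G t.
Arguments op_id {R V}.

Definition tdiff (R : comPzRingType) (V : chainComplex R) (n : nat)
    (t : tpow V n) : tpow V n :=
  \sum_(i < n)
    tens n n (nseq i op_id ++ op_unary (-1) (cdiff V) :: nseq (n - i.+1) op_id)
      t.

(* Only the operations mu_n with n >= 2 are meaningful. *)
Definition A_infinity (R : comPzRingType) (V : chainComplex R)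
    (mu : forall n, {linear tpow V n -> V}) : Prop :=
  forall n, (2 <= n)%N ->
    thas_degree (n%:Z - 2) (mu n) /\
    forall t : tpow V n,
      cdiff V (mu n t) - ksign R (n%:Z - 2) *: mu n (tdiff t) =
      \sum_(k < n.+1) \sum_(l < n.+1 | [&& k + l == n.+1, 2 <= k & 2 <= l]%N)
        \sum_(1 <= i < k.+1)
          ksign R (i * (l + 1) + n)%N *:
            mu k (tens n k (nseq i.-1 op_id
                            ++ Operation (l%:Z - 2) (mu l)
                            :: nseq (k - i) op_id) t).

(* h o p_r, a map of degree r - 1, with the convention h o p_1 = id. *)
Definition hp (R : comPzRingType) (V : chainComplex R) (h : {linear V -> V})
    (p : forall n, {linear tpow V n -> V}) (r : nat) : operation V :=
  if r == 1%N then op_id else @Operation R V r (r%:Z - 1) (h \o p r).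

(* [Node s] is a tree whose root vertex has the planar trees s attached to its
   incoming edges; a [Leaf] in s means that the edge is a leaf. *)
Inductive tree := Leaf | Node of seq tree.

Fixpoint leaves (T : tree) : nat :=
  if T is Node s then sumn [seq leaves c | c <- s] else 1%N.

(* Each vertex is represented by the subtree of which it is the root. *)
Fixpoint vertices (T : tree) : seq (seq tree) :=
  if T is Node s then s :: flatten [seq vertices c | c <- s] else [::].

Definition reduced (T : tree) : bool :=
  all (fun s => 2 <= size s)%N (vertices T).

Definition vartheta_tree (T : tree) : int :=
  \sum_(s <- vertices T) vartheta [seq (leaves c)%:Z | c <- s].

Fixpoint enc (T : tree) : GenTree.tree unit :=
  if T is Node s then GenTree.Node 0%N [seq enc c | c <- s] else GenTree.Leaf tt.

Fixpoint dec (T : GenTree.tree unit) : tree :=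
  if T is GenTree.Node _ s then Node [seq dec c | c <- s] else Leaf.

Fixpoint tree_ind' (Q : tree -> Prop) (hL : Q Leaf)
    (hN : forall s, foldr (fun c P => Q c /\ P) True s -> Q (Node s)) T : Q T :=
  match T with
  | Leaf => hL
  | Node s => hN s ((fix loop s : foldr (fun c P => Q c /\ P) True s :=
      match s with
      | [::] => I
      | c :: s' => conj (tree_ind' hL hN c) (loop s')
      end) s)
  end.

Lemma encK : cancel enc dec.
Proof.
elim/tree_ind' => //= s hs; congr Node.
by elim: s hs => //= c s IH [-> /IH ->].
Qed.

HB.instance Definition _ := Countable.copy tree (can_type encK).

Definition reduced_planar (n : nat) (T : tree) : bool :=
  reduced T && (leaves T == n).

(* P_n; since every interior edge carries the same decoration h, the
   decoration is not recorded. *)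
Definition planar (n : nat) : Type := {T : tree | reduced_planar n T}.
HB.instance Definition _ n := Countable.on (planar n).

Section PlanarFinite.

Lemma reduced_node s : reduced (Node s) = (2 <= size s)%N && all reduced s.
Proof.
rewrite /reduced /=; congr (_ && _).
by elim: s => //= c s IH; rewrite all_cat IH.
Qed.

Lemma leaves_gt0 T : reduced T -> (0 < leaves T)%N.
Proof.
elim/tree_ind': T => // -[|c s] hs; rewrite reduced_node //= => /and3P[_ hc _].
by case: hs => /(_ hc) h _; rewrite addn_gt0 h.
Qed.

Fixpoint seqs_upto (m : nat) (l : seq tree) : seq (seq tree) :=
  if m is m'.+1 then
    [::] :: [seq c :: s | c <- l, s <- seqs_upto m' l]
  else [:: [::]].

Lemma mem_seqs_upto m l s :
  (size s <= m)%N -> {subset s <= l} -> s \in seqs_upto m l.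
Proof.
elim: m s => [|m IH] [|c s] //= hsz hs; rewrite inE /=.
apply: allpairs_f; first by apply: hs; rewrite mem_head.
by apply: IH => // x hx; apply: hs; rewrite inE hx orbT.
Qed.

Fixpoint trees_upto (d : nat) : seq tree :=
  if d is d'.+1 then Leaf :: [seq Node s | s <- seqs_upto d.+1 (trees_upto d')]
  else [:: Leaf].

Lemma size_leaves s : all reduced s -> (size s <= leaves (Node s))%N.
Proof.
elim: s => //= c s IH /andP[hc /IH hs].
by rewrite -add1n leq_add // leaves_gt0.
Qed.

Lemma leaves_child s c : all reduced s -> (2 <= size s)%N -> c \in s ->
  (leaves c < leaves (Node s))%N.
Proof.
move=> hs hsz hc; have hp := perm_to_rem hc.
have hr : all reduced (rem c s) by apply/allP => x /mem_rem /(allP hs).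
have -> : leaves (Node s) = (leaves c + leaves (Node (rem c s)))%N.
  by rewrite /= (perm_sumn (perm_map leaves hp)).
rewrite -{1}[leaves c]addn0 ltn_add2l.
apply: leq_trans (size_leaves hr).
by rewrite size_rem // -ltnS prednK // (ltn_trans _ hsz).
Qed.

Lemma mem_trees_upto d T :
  reduced T -> (leaves T <= d.+1)%N -> T \in trees_upto d.
Proof.
elim: d T => [|d IH] [|s]; rewrite ?mem_head // reduced_node => /andP[h2 hs] hd.
  by have := leq_trans h2 (leq_trans (size_leaves hs) hd).
rewrite inE; apply/orP; right; apply: map_f; apply: mem_seqs_upto.
  exact: leq_trans (size_leaves hs) hd.
move=> c hc; apply: IH; first exact: (allP hs).
by rewrite -ltnS; apply: leq_trans hd; apply: leaves_child.
Qed.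

Definition planar_enum (n : nat) : seq (planar n) :=
  pmap insub (undup (trees_upto n)).

Lemma planar_enumP n : Finite.axiom (planar_enum n).
Proof.
move=> T; rewrite count_uniq_mem; last exact: pmap_sub_uniq (undup_uniq _).
rewrite mem_pmap_sub mem_undup; have /andP[hr /eqP hl] := valP T.
by rewrite mem_trees_upto // hl.
Qed.

HB.instance Definition _ n := isFinite.Build (planar n) (@planar_enumP n).

End PlanarFinite.

Section TreeMap.
Context (R : comPzRingType) (V : gradedModule R).
Context (h : {linear V -> V}) (mu : forall n, {linear tpow V n -> V}).

(* The factor G_j contributed by an incoming edge: id for a leaf, and
   h o F_T for an interior edge carrying the subtree T.  As F_T has degree
   (number of leaves) - 2, the latter has degree (number of leaves) - 1. *)
Fixpoint branch (T : tree) : operation V :=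
  if T is Node s then
    @Operation R V (leaves T) ((leaves T)%:Z - 1)
      (h \o (mu (size s) \o
             tens (leaves T) (size s) [seq branch c | c <- s]))
  else op_id.

(* F_T : V^{(x) n} -> V for a tree T with n leaves; the value at the tree
   without vertices is junk. *)
Definition tree_map (n : nat) (T : tree) (t : tpow V n) : V :=
  if T is Node s then
    mu (size s) (tens n (size s) [seq branch c | c <- s] t)
  else 0.

End TreeMap.

(* Main.v *)
(* Induction on n.  By induction each h o p_(r_i) in the recursion is a signed
   sum of branches h o F_(T_i), with id matching the leaf when r_i = 1.  The
   tensor product distributes over these sums, so p_n becomes a sum over the
   choices of k, of r_1, ..., r_k and of trees T_i with r_i leaves; grafting
   the T_i onto a common root is a bijection onto P_n, and it adds
   vartheta(r_1, ..., r_k) to the sum of the vartheta(T_i).  Replacing h o p_r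
   by the branches creates no further Koszul sign, as all of them have degree
   r - 1. *)
Require Import Defs.
From mathcomp Require Import all_boot all_order all_algebra.
From mathcomp Require Import zify fsbigop.

Set Implicit Arguments.
Unset Strict Implicit.
Unset Printing Implicit Defensive.

Import GRing.Theory.
Local Open Scope ring_scope.

(** * Koszul signs and products of lists *)

Lemma ksignD (R : pzRingType) (a b : int) :
  ksign R (a + b) = ksign R a * ksign R b.
Proof.
(* [|a + b|] and [|a| + |b|] have the same parity. *)
rewrite /ksign -exprD -signr_odd -[RHS]signr_odd; congr (_ ^+ nat_of_bool _).
by lia.
Qed.

Lemma ksign0 (R : pzRingType) : ksign R 0 = 1.
Proof. exact: expr0. Qed.

Lemma ksign_sum (R : comPzRingType) (I : Type) (s : seq I) (F : I -> int) :
  ksign R (\sum_(i <- s) F i) = \prod_(i <- s) ksign R (F i).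
Proof. by apply: (big_morph _ (@ksignD R)); apply: ksign0. Qed.

(** Indexes the terms of an expanded tensor product: one summand is picked from each factor. *)
Fixpoint seq_prod (A : Type) (ls : seq (seq A)) : seq (seq A) :=
  if ls is l :: ls' then [seq a :: s | a <- l, s <- seq_prod ls'] else [:: [::]].

Lemma mem_seq_prod (A : eqType) (ls : seq (seq A)) (s : seq A) :
  (s \in seq_prod ls) = all2 (fun a l => a \in l) s ls.
Proof.
elim: ls s => [|l ls IH] [|a s] //=; first by apply/allpairsP => -[[? ?] []].
rewrite -IH; apply/allpairsP/andP => [[[b u] /= [hb hu [-> ->]]] //|[ha hs]].
by exists (a, s).
Qed.

Lemma seq_prod_uniq (A : eqType) (ls : seq (seq A)) :
  all uniq ls -> uniq (seq_prod ls).
Proof.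
elim: ls => //= l ls IH /andP[hl /IH hls].
by apply: allpairs_uniq => // -[a s] [b u] _ _ [-> ->].
Qed.

Lemma multilinear_sum (R : pzRingType) (V U : lmodType R) (n : nat)
    (f : seq V -> U) (I : Type) (r : seq I) (c : I -> R) (F : I -> V) s1 s2 :
  multilinear n f -> (size s1 + size s2).+1 = n ->
  f (s1 ++ (\sum_(i <- r) c i *: F i) :: s2) =
  \sum_(i <- r) c i *: f (s1 ++ F i :: s2).
Proof.
move=> hf hn; elim: r => [|i r IH]; last by rewrite !big_cons hf // IH.
(* Multilinearity with scalar -1 and two zero vectors shows that [f] vanishes when a slot is 0. *)
rewrite !big_nil; have := hf s1 s2 (-1) 0 0 hn.
by rewrite scaler0 addr0 scaleN1r addNr.
Qed.

(** * Distributivity of tensor products over sums of operations *)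

Section TensorDistributivity.
Context (R : comPzRingType) (V : gradedModule R) (A : eqType).
Context (B : A -> operation V) (c : A -> R).

(* Phrased on pure tensors because the arities of [G] and of the [B a] are only
   propositionally equal; on sequences of the wrong length both sides are 0. *)
Definition op_decomposes (G : operation V) (l : seq A) : Prop :=
  (forall a, a \in l ->
     op_arity (B a) = op_arity G /\ op_degree (B a) = op_degree G) /\
  forall x, G (tensor (op_arity G) x) =
    \sum_(a <- l) c a *: B a (tensor (op_arity (B a)) x).

Context (I : eqType) (G : I -> operation V) (l : I -> seq A).

(** Equal arities cut the input at the same places, and equal degrees produce the same Koszul
    twists. *)
Lemma decomposes_shape (r : seq I) (s : seq A) :
  (forall i, i \in r -> op_decomposes (G i) (l i)) ->
  s \in seq_prod [seq l i | i <- r] ->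
  [seq op_arity a | a <- [seq B a | a <- s]] =
    [seq op_arity a | a <- [seq G i | i <- r]] /\
  [seq op_degree a | a <- [seq B a | a <- s]] =
    [seq op_degree a | a <- [seq G i | i <- r]].
Proof.
rewrite mem_seq_prod; elim: r s => [|i r IH] [|a s] //= hG /andP[ha hs].
have [|-> ->] := IH s _ hs; first by move=> j hj; apply: hG; rewrite inE hj orbT.
by have [/(_ _ ha)[-> ->] _] := hG i (mem_head _ _).
Qed.

(** Factors are expanded from left to right: [pre] collects those already expanded, and
    multilinearity applies in the slot after it. *)
Lemma tensor_factors_distr (k : nat) (r : seq I) (pre x : seq V) :
  (forall i, i \in r -> op_decomposes (G i) (l i)) ->
  (size pre + size r)%N = k ->
  tensor k (pre ++ tens_factors [seq G i | i <- r] x) =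
  \sum_(s <- seq_prod [seq l i | i <- r])
    (\prod_(a <- s) c a) *: tensor k (pre ++ tens_factors [seq B a | a <- s] x).
Proof.
elim: r pre x => [|i r IH] pre x hG hk /=.
  by rewrite big_seq1 big_nil scale1r.
have hG' j : j \in r -> op_decomposes (G j) (l j).
  by move=> hj; apply: hG; rewrite inE hj orbT.
have [hl hi] := hG i (mem_head _ _).
rewrite hi (multilinear_sum _ _ _ (@tensor_multilinear _ _ k)); last first.
  by rewrite size_tens_factors size_map -addnS.
rewrite big_allpairs_dep; apply: eq_big_seq => a /hl[hara hdega] /=.
rewrite -cat_rcons IH //; last by rewrite size_rcons addSnnS.
rewrite scaler_sumr; apply: eq_big_seq => s hs.
(* The twist inside the first factor depends only on the total degree of the later ones, which is
   the same for [s] as for [r]. *)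
have [_ hdeg] := decomposes_shape hG' hs.
rewrite big_cons scalerA cat_rcons -hara.
by rewrite -(big_map (@op_degree R V) xpredT id) -hdeg big_map.
Qed.

(** Both sides are linear and pure tensors span. Since arities agree, no choice [s] falls into the
    junk value 0. *)
Lemma tens_distr (n k : nat) (r : seq I) (t : tpow V n) :
  (forall i, i \in r -> op_decomposes (G i) (l i)) ->
  tens_shape n k [seq G i | i <- r] ->
  tens n k [seq G i | i <- r] t =
  \sum_(s <- seq_prod [seq l i | i <- r])
    (\prod_(a <- s) c a) *: tens n k [seq B a | a <- s] t.
Proof.
move=> hG hsh.
have hsh' s : s \in seq_prod [seq l i | i <- r] ->
    tens_shape n k [seq B a | a <- s].
  move=> hs; have [ha _] := decomposes_shape hG hs.
  by rewrite /tens_shape -(size_map (@op_arity R V)) ha size_map.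
have key (q : n.-tuple V) : tens n k [seq G i | i <- r] (tensor n q) =
    \sum_(s <- seq_prod [seq l i | i <- r])
      (\prod_(a <- s) c a) *: tens n k [seq B a | a <- s] (tensor n q).
  rewrite tensE ?size_tuple // -[tens_factors _ _]cat0s tensor_factors_distr //.
    apply: eq_big_seq => s /hsh' hs; rewrite tensE ?size_tuple //.
  by case/andP: hsh => /eqP; rewrite size_map.
rewrite {1}(tpow_span t) linear_sum /=.
under eq_bigr do rewrite linearZ /= key scaler_sumr.
rewrite exchange_big; apply: eq_bigr => s _ /=.
have -> : tens n k [seq B a | a <- s] t =
    \sum_(q <- trepr t) q.1 *: tens n k [seq B a | a <- s] (tensor n q.2).
  rewrite {1}(tpow_span t) linear_sum; apply: eq_bigr => q _.
  exact: linearZ.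
by rewrite scaler_sumr; apply: eq_bigr => q _; rewrite !scalerA mulrC.
Qed.

End TensorDistributivity.

(** * Planar trees and grafting *)

Definition children (T : tree) : seq tree := if T is Node s then s else [::].

(** Bare trees rather than [planar n], so that subtrees with different numbers of leaves fit in one
    list of children. *)
Definition planar_trees (n : nat) : seq tree := [seq val T | T : planar n].

Lemma planar_trees_uniq n : uniq (planar_trees n).
Proof. by rewrite map_inj_uniq ?enum_uniq //; apply: val_inj. Qed.

Lemma mem_planar_trees n T : (T \in planar_trees n) = reduced_planar n T.
Proof.
apply/mapP/idP => [[S _ ->]|hT]; first exact: (valP S).
by exists (Sub T hT); rewrite ?mem_enum ?SubK.
Qed.

Lemma sum_planar (U : nmodType) n (P : pred tree) (F : tree -> U) :
  \sum_(T : planar n | P (val T)) F (val T) =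
  \sum_(T <- planar_trees n | P T) F T.
Proof. by rewrite big_map big_enum_cond. Qed.

(** A root vertex would have at least two children, each carrying a leaf. This matches the
    convention that [h] after [p 1] is the identity. *)
Lemma reduced_one_leaf T : reduced T -> leaves T = 1%N -> T = Leaf.
Proof.
case: T => // s; rewrite reduced_node => /andP[h2 hs] h1.
by have := leq_trans h2 (size_leaves hs); rewrite h1.
Qed.

Lemma mem_seq_prod_planar (r : seq nat) (s : seq tree) :
  (s \in seq_prod [seq planar_trees i | i <- r]) =
  all reduced s && ([seq leaves c | c <- s] == r).
Proof.
rewrite mem_seq_prod; elim: r s => [|i r IH] [|c s] //=; first by rewrite andbF.
by rewrite IH mem_planar_trees /reduced_planar eqseq_cons andbACA.
Qed.

Lemma vartheta_tree_node s :
  vartheta_tree (Node s) =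
  vartheta [seq (leaves c)%:Z | c <- s] + \sum_(c <- s) vartheta_tree c.
Proof.
rewrite /vartheta_tree /= big_cons; congr (_ + _).
by rewrite big_flatten big_map.
Qed.

(* A tree in P_n is determined by the arity k of its root, the numbers
   r_1, ..., r_k of leaves above the edges of the root, and the k subtrees. *)
Lemma sum_planar_root (U : nmodType) (n : nat) (F : tree -> U) : (1 < n)%N ->
  \sum_(T : planar n) F (val T) =
  \sum_(2 <= k < n.+1)
    \sum_(r : k.-tuple 'I_n.+1 | [forall i, 0 < tnth r i]%N
                                 && (\sum_(i < k) tnth r i == n)%N)
      \sum_(s <- seq_prod [seq planar_trees (nat_of_ord i) | i <- r]) F (Node s).
Proof.
move=> hn.
have planarP (T : planar n) : exists s, [/\ val T = Node s, all reduced s,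
    (1 < size s)%N, (size s <= n)%N & sumn [seq leaves c | c <- s] = n].
  have /andP[] := valP T; case: (val T) => [_ /eqP /= h|s].
    by rewrite -h in hn.
  rewrite reduced_node => /andP[h2 hs] /eqP hl; exists s; split=> //.
  by rewrite -[leqRHS]hl; apply: size_leaves.
rewrite (big_nat_widenl _ 0%N) // big_mkord.
(* [inord] is faithful here: the root arity is at most the number [n] of leaves. *)
pose ar (T : tree) : 'I_n.+1 := inord (size (children T)).
rewrite (partition_big (fun T : planar n => ar (val T)) (fun k => 2 <= k)%N);
  last first.
  by move=> T _; have [s [-> _ h1 h2 _]] := planarP T; rewrite /ar /= inordK.
apply: eq_bigr => k hk.
pose lv (T : tree) : k.-tuple 'I_n.+1 :=
  [tuple inord (leaves (nth Leaf (children T) i)) | i < k].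
have lvE s : size s = k -> sumn [seq leaves c | c <- s] = n ->
    [seq nat_of_ord i | i <- lv (Node s)] = [seq leaves c | c <- s].
  move=> hsz hl; apply: (@eq_from_nth _ 0%N).
    by rewrite !size_map -enumT size_enum_ord.
  move=> i; rewrite size_map size_tuple => hi.
  rewrite (nth_map ord0) ?size_tuple // (nth_map Leaf) ?hsz //.
  rewrite -[i]/(nat_of_ord (Ordinal hi)) -tnth_nth tnth_mktuple /= inordK //.
  (* The leaf count of a child is one summand of [n], so [inord] preserves it. *)
  rewrite ltnS -[leqRHS]hl -(cat_take_drop i s) (drop_nth Leaf) ?hsz //.
  rewrite nth_cat size_take hsz hi ltnn subnn /= map_cat sumn_cat /=.
  by rewrite addnCA leq_addr.
have rE (r : k.-tuple 'I_n.+1) :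
    (\sum_(i < k) tnth r i)%N = sumn [seq nat_of_ord i | i <- r].
  by rewrite sumnE big_map big_tuple.
have rP (r : k.-tuple 'I_n.+1) :
    [forall i, 0 < tnth r i]%N = all (leq 1) [seq nat_of_ord i | i <- r].
  apply/forallP/allP => [h _ /mapP[i /tnthP[j ->] ->] // | h i].
  by apply: h; rewrite map_f // mem_tnth.
rewrite (partition_big (fun T : planar n => lv (val T))
  (fun r => [forall i, 0 < tnth r i]%N && (\sum_(i < k) tnth r i == n)%N)).
  apply: eq_bigr => r /andP[]; rewrite rP rE => hr /eqP hrn.
  (* Both sides become sums over duplicate-free lists of trees, compared by membership. *)
  rewrite (sum_planar n (fun T => (ar T == k) && (lv T == r))) -big_filter.
  rewrite -[RHS](big_map Node xpredT F); apply: perm_big; apply: uniq_perm.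
  - by rewrite filter_uniq // planar_trees_uniq.
  - rewrite map_inj_uniq; last by move=> ? ? [].
    by apply: seq_prod_uniq; apply/allP => _ /mapP[i _ ->]; apply: planar_trees_uniq.
  - have -> : [seq planar_trees (nat_of_ord i) | i <- r] =
        [seq planar_trees i | i <- [seq nat_of_ord i | i <- r]].
      by rewrite -map_comp.
    move=> T; rewrite mem_filter mem_planar_trees; apply/idP/mapP.
    + move=> /andP[/andP[/eqP hT /eqP hlv] hpl].
      have [s [/= eT hs h1 h2 hl]] := planarP (Sub T hpl).
      rewrite {T}eT in hT hlv hpl *; exists s => //.
      rewrite mem_seq_prod_planar hs -hlv lvE ?eqxx //.
      by rewrite -hT /ar /= inordK.
    + case=> s; rewrite mem_seq_prod_planar => /andP[hs /eqP hlr] ->.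
      have hl : sumn [seq leaves c | c <- s] = n by rewrite hlr.
      have hsz : size s = k by rewrite -(size_map leaves) hlr size_map size_tuple.
      rewrite /reduced_planar reduced_node hsz hk hs /= hl eqxx !andbT.
      apply/andP; split; first by rewrite /ar /= hsz inord_val.
      apply/eqP/val_inj; apply: (inj_map (@ord_inj _)).
      by rewrite lvE.
(* It remains that the leaf counts of the root's children are positive and add up to [n]. *)
move=> T /=; have [s [-> hs h1 h2 hl]] := planarP T.
rewrite -(inj_eq (@ord_inj _)) /ar /= inordK // => /eqP hsz.
rewrite rP rE lvE // hl eqxx andbT; apply/allP => _ /mapP[c hc ->].
by apply: leaves_gt0; apply: (allP hs).
Qed.

(** * From the recursion to the sum over trees *)

Lemma ktwist0 (R : comPzRingType) (V : gradedModule R) (x : V) : ktwist 0 x = x.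
Proof.
rewrite -[RHS](gproj_sum x); apply: eq_fsbigr => i _.
by rewrite mul0r ksign0 scale1r.
Qed.

Lemma op_idE (R : comPzRingType) (V : gradedModule R) (x : V) :
  op_id (tensor 1 [:: x]) = x.
Proof. by rewrite /= /tpow1 tliftE. Qed.

(** Identities have degree 0, hence cause no twist; this serves the only term of the recursion at n
    = 2. *)
Lemma tens_id2 (R : comPzRingType) (V : gradedModule R) (t : tpow V 2) :
  tens 2 2 [:: op_id; op_id] t = t.
Proof.
rewrite (tpow_span t) linear_sum; apply: eq_bigr => -[c x] _ /=.
rewrite linearZ; congr (_ *: _).
rewrite /= tensE ?size_tuple //; case: x => -[|x [|y []]] //= _.
by rewrite big_seq1 big_nil !ktwist0 !op_idE.
Qed.

Section Recursion.
Context (R : comPzRingType) (V : chainComplex R).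
Context (h : {linear V -> V}) (mu p : forall n, {linear tpow V n -> V}).

Lemma op_arity_branch T : op_arity (branch h mu T) = leaves T.
Proof. by case: T. Qed.

Lemma op_degree_branch T : op_degree (branch h mu T) = (leaves T)%:Z - 1.
Proof. by case: T. Qed.

Lemma op_arity_hp r : op_arity (hp h p r) = r.
Proof. by rewrite /hp; case: eqP. Qed.

Lemma hp_decomposes r : (0 < r)%N ->
  ((1 < r)%N -> forall t : tpow V r, p r t =
     \sum_(T : planar r)
       ksign R (vartheta_tree (val T)) *: tree_map h mu (val T) t) ->
  op_decomposes (branch h mu) (fun T => ksign R (vartheta_tree T))
    (hp h p r) (planar_trees r).
Proof.
move=> r0 hp_r; split=> [T|x].
  rewrite mem_planar_trees => /andP[_ /eqP hl].
  rewrite op_arity_branch op_degree_branch op_arity_hp hl; split=> //.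
  by rewrite /hp; case: eqP => // ->.
have [r1|r1] := eqVneq r 1%N.
  (* For r = 1 the only tree is the leaf, whose branch is the identity. *)
  have -> : \sum_(T <- planar_trees r)
      ksign R (vartheta_tree T) *:
        branch h mu T (tensor (op_arity (branch h mu T)) x) =
    \sum_(T <- [:: Leaf])
      ksign R (vartheta_tree T) *:
        branch h mu T (tensor (op_arity (branch h mu T)) x).
    apply: perm_big; apply: uniq_perm; rewrite ?planar_trees_uniq // => T.
    rewrite mem_planar_trees inE r1; apply/andP/eqP => [[hT /eqP]|-> //].
    exact: reduced_one_leaf.
  by rewrite big_seq1 /vartheta_tree big_nil ksign0 scale1r /hp r1.
have lt1r : (1 < r)%N by rewrite ltn_neqAle eq_sym r1.
rewrite /hp (negPf r1) /= hp_r // linear_sum /= (sum_planar r xpredT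
  (fun T => h (ksign R (vartheta_tree T) *: tree_map h mu T (tensor r x)))).
apply: eq_big_seq => -[|s]; rewrite mem_planar_trees => /andP[_ /eqP hl].
  by rewrite -hl in r1.
(* Eliminating [hl] replaces [r] by [leaves (Node s)], so that both tensor powers have the same
   type. *)
by rewrite linearZ /=; case: _ / hl.
Qed.

Hypothesis p_rec : forall n, (1 < n)%N -> forall t : tpow V n,
  p n t =
  \sum_(2 <= k < n.+1)
    \sum_(r : k.-tuple 'I_n.+1 | [forall i, 0 < tnth r i]%N
                                 && (\sum_(i < k) tnth r i == n)%N)
      ksign R (vartheta [seq (nat_of_ord i)%:Z | i <- r]) *:
        mu k (tens n k [seq hp h p (nat_of_ord i) | i <- r] t).

(** Since [p_rec] already covers n = 2, strong induction needs no separate base case. *)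
Lemma recursion_tree_sum n (t : tpow V n) : (1 < n)%N ->
  p n t = \sum_(T : planar n)
            ksign R (vartheta_tree (val T)) *: tree_map h mu (val T) t.
Proof.
elim/ltn_ind: n t => n IH t hn.
rewrite p_rec // (sum_planar_root
  (fun T => ksign R (vartheta_tree T) *: tree_map h mu T t)) //.
apply: eq_big_nat => k /andP[hk _]; apply: eq_bigr => r /andP[/forallP hr /eqP hrn].
(* As k is at least 2, some other positive part [j] (index 1 if [i] is 0, else index 0) keeps part
   [i] below [n]. *)
have r_lt (i : 'I_k) : (tnth r i < n)%N.
  have [j hj] : exists j : 'I_k, j != i.
    exists (if nat_of_ord i == 0%N then Ordinal hk else Ordinal (ltnW hk)).
    by rewrite -(inj_eq (@ord_inj _)); case: i => -[].
  rewrite -[ltnRHS]hrn (bigD1 i) //= (bigD1 j) //= -[ltnLHS]addn0 ltn_add2l.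
  by rewrite addn_gt0 hr.
have dec i : i \in val r -> op_decomposes (branch h mu)
    (fun T => ksign R (vartheta_tree T)) (hp h p i) (planar_trees i).
  move=> /tnthP[j ->]; apply: hp_decomposes => // hj u.
  exact: IH.
have hsh : tens_shape n k [seq hp h p (nat_of_ord i) | i <- r].
  rewrite /tens_shape size_map size_tuple eqxx /= -map_comp.
  rewrite sumnE big_map big_tuple -[eqbRHS]hrn.
  by under eq_bigr do rewrite /= op_arity_hp.
rewrite (tens_distr t dec hsh) linear_sum scaler_sumr.
apply: eq_big_seq => s hs /=.
move: hs; have -> : [seq planar_trees (nat_of_ord i) | i <- r] =
    [seq planar_trees i | i <- [seq nat_of_ord i | i <- r]].
  by rewrite -map_comp.
rewrite mem_seq_prod_planar => /andP[_ /eqP hl].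
have hsz : size s = k by rewrite -(size_map leaves) hl size_map size_tuple.
(* The root sign times the product of the subtree signs is the sign of the grafted tree. *)
rewrite linearZ scalerA vartheta_tree_node ksignD ksign_sum /= hsz.
by rewrite (map_comp Posz leaves) hl -map_comp.
Qed.

End Recursion.

(** * The case n = 2 and the conclusion *)

Theorem proposition6 (R : comPzRingType) (V W : chainComplex R)
    (f : {linear V -> W}) (g : {linear W -> V}) (h : {linear V -> V})
    (mu : forall n, {linear tpow V n -> V})
    (p : forall n, {linear tpow V n -> V})
    (f_chain : chain_map f) (g_chain : chain_map g)
    (h_homotopy : chain_homotopy h (g \o f) idfun)
    (mu_A_infinity : A_infinity mu)
    (p_two : forall t : tpow V 2, p 2 t = mu 2 t)
    (p_rec : forall n, (2 < n)%N -> forall t : tpow V n,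
      p n t =
      \sum_(2 <= k < n.+1)
        \sum_(r : k.-tuple 'I_n.+1 | [forall i, 0 < tnth r i]%N
                                     && (\sum_(i < k) tnth r i == n)%N)
          ksign R (vartheta [seq (nat_of_ord i)%:Z | i <- r]) *:
            mu k (tens n k [seq hp h p (nat_of_ord i) | i <- r] t))
    (n : nat) (hn : (2 <= n)%N) (t : tpow V n) :
  p n t = \sum_(T : planar n)
            ksign R (vartheta_tree (val T)) *: tree_map h mu (val T) t.
Proof.
apply: recursion_tree_sum => // m; rewrite leq_eqVlt => /predU1P[<- u|]; last exact: p_rec.
(* To put [p 2] in recursive form: only k = 2 occurs, and (1, 1) is the only composition of 2 into
   two positive parts. *)
rewrite p_two big_nat1.
pose i1 : 'I_3 := inord 1.
have i1E : nat_of_ord i1 = 1%N by rewrite inordK.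
rewrite (big_pred1 [tuple i1; i1]).
  (* Here 1 * (1 + 1) = 2 is even, so the sign is +1. *)
  have -> : vartheta [seq (nat_of_ord i)%:Z | i <- [tuple i1; i1]] = 2.
    rewrite /vartheta /= i1E big_ord_recl big_ord1 big1 //.
    by rewrite big_mkcond !big_ord_recl big_ord0.
  by rewrite /= i1E tens_id2 /ksign sqrrN expr1n scale1r.
move=> r; apply/andP/eqP => [[/forallP]|->]; last first.
  split; first by apply/forallP => -[[|[|//]] ?]; rewrite (tnth_nth ord0) /= i1E.
  by rewrite !big_ord_recl big_ord0 !(tnth_nth ord0) /= i1E.
case: r => -[|a [|b [|]]] // hsz hr.
have := hr ord0; have := hr ord_max.
rewrite !big_ord_recl big_ord0 !(tnth_nth ord0) /= => a0 b0 hab.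
by apply: val_inj; congr [:: _; _]; apply: ord_inj; rewrite i1E; lia.
Qed.
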